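(* If $T$ is a tree of order $n$ with radius $r=\mathrm{rad}(T)$, then $$\mathrm{aecc}_3(T)\ge \mathrm{aecc}_3(T'_{n,2r-1}).$$
   Context: For a connected graph $G$ with $n(G)$ vertices and $S\subseteq V(G)$, the Steiner distance $d_G(S)$ is the minimum number of edges of a connected subgraph of $G$ containing $S$. For $v\in V(G)$, $\mathrm{ecc}_3(v,G)=\max\{d_G(S): v\in S\subseteq V(G), |S|=3\}$, and $\mathrm{aecc}_3(G)=\frac{1}{n(G)}\sum_{v\in V(G)}\mathrm{ecc}_3(v,G)$. The radius $\mathrm{rad}(G)$ is the minimum (usual) eccentricity of the vertices of $G$. Let $T_{n,d}(p_1,\ldots,p_{d-1})$ be the tree of order $n$ obtained from a path $v_0v_1\ldots v_d$ by attaching $p_i\ge 0$ pendent vertices to $v_i$ for every $i\in\{1,\ldots,d-1\}$, so that $\sum_{i=1}^{d-1}p_i=n-d-1$. For odd $d$, $T'_{n,d}$ denotes the tree of this kind in which $\lfloor (n-d-1)/2\rfloor$ pendent vertices are attached to $v_{\lfloor d/2\rfloor}$ and $\lceil (n-d-1)/2\rceil$ pendent vertices are attached to $v_{\lceil d/2\rceil}$.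
   Formalization: The radius is assumed to be at least 2; for r = 1 the tree T'_{n,1} is not in the defined family (and attaching pendants at the path's ends makes the inequality false, e.g. n = 4), and for r = 0 it is undefined. *)

(* Defs.v *)
From mathcomp Require Import all_boot all_order all_algebra.
Set Implicit Arguments.
Unset Strict Implicit.
Unset Printing Implicit Defensive.

Record sgraph := SGraph {
  vertex :> finType;
  adj : rel vertex;
  adj_sym : symmetric adj;
  adj_irr : irreflexive adj
}.

Section GraphNotions.
Variable G : sgraph.

Definition connected_graph := forall x y : G, connect (@adj G) x y.

Definition acyclic_graph :=
  forall c : seq G, 2 < size c -> ~ ucycle (@adj G) c.

Definition is_tree := [/\ 0 < #|G|, connected_graph & acyclic_graph].

(* The default value #|G| of the two minima below is never reached when G is
   connected and nonempty: distances and eccentricities are then < #|G|. *)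
Definition dist (x y : G) : nat :=
  \big[minn/#|G|]_(k < #|G| |
      [exists p : k.-tuple G, path (@adj G) x p && (last x p == y)]) k.

Definition ecc (x : G) : nat := \max_(y : G) dist x y.

Definition radius : nat := \big[minn/#|G|]_(x : G) ecc x.

Definition edges : {set {set G}} :=
  [set A | [exists x : G, exists y : G, adj x y && (A == [set x; y])]].

(* (H.1, H.2) = (vertex set, edge set) *)
Definition is_subgraph (H : {set G} * {set {set G}}) : bool :=
  (H.2 \subset edges) && [forall A in H.2, A \subset H.1].

Definition connected_subgraph (H : {set G} * {set {set G}}) : bool :=
  is_subgraph H &&
  [forall x in H.1, forall y in H.1,
     connect [rel u v : G | [set u; v] \in H.2] x y].

(* When G is connected, G itself is one of the subgraphs in the range, so the
   default value #|edges| does not affect the minimum. *)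
Definition steiner_dist (S : {set G}) : nat :=
  \big[minn/#|edges|]_(H : {set G} * {set {set G}} |
      connected_subgraph H && (S \subset H.1)) #|H.2|.

Definition ecc3 (v : G) : nat :=
  \max_(S : {set G} | (v \in S) && (#|S| == 3)) steiner_dist S.

Definition aecc3 : rat := ((\sum_(v : G) ecc3 v)%:R / #|G|%:R)%R.

End GraphNotions.

(* T_{n,d}(p_1, ..., p_{d-1}) with n = d + 1 + \sum_(1 <= i < d) p i.
   [inl i] is the path vertex v_i; [inr (Tagged _ k)] with tag i : 'I_d.-1 is
   the k-th pendent vertex attached to v_{i+1}. Only p 1, ..., p d.-1 matter. *)
Section PathWithPendants.
Variables (d : nat) (p : nat -> nat).

Definition pp_vertex : finType :=
  ('I_d.+1 + {i : 'I_d.-1 & 'I_(p i.+1)})%type.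

Definition pp_adj (x y : pp_vertex) : bool :=
  match x, y with
  | inl i, inl j => (i.+1 == j) || (j.+1 == i)
  | inl i, inr u => (i : nat) == (tag u).+1
  | inr u, inl i => (i : nat) == (tag u).+1
  | inr _, inr _ => false
  end.

Lemma pp_adj_sym : symmetric pp_adj.
Proof. by case=> [i|u] [j|w] //=; rewrite orbC. Qed.

Lemma pp_adj_irr : irreflexive pp_adj.
Proof. by case=> [i|u] //=; rewrite orbb gtn_eqF. Qed.

Definition path_with_pendants : sgraph := SGraph pp_adj_sym pp_adj_irr.

End PathWithPendants.

(* T'_{n,d}, for d odd, d >= 3 and n >= d + 1. For d = 1 the vertices
   v_{d./2} and v_{uphalf d} are the ends of the path, where no pendent vertex
   may be attached, so T'_{n,1} does not exist for n > 2. *)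
Definition Tprime_pendants (n d i : nat) : nat :=
  if i == d./2 then (n - d - 1)./2
  else if i == uphalf d then uphalf (n - d - 1) else 0.

Definition Tprime (n d : nat) : sgraph :=
  path_with_pendants d (Tprime_pendants n d).

(* Main.v *)
(** A tree T of radius r has diameter D >= 2r - 1, since the middle vertex of a
    longest geodesic P has eccentricity at most the ceiling of D / 2. Every
    edge of a tree is a bridge, so a connected subgraph containing the ends of
    P contains all D edges of P, and at least one more if it meets a vertex off
    P. Hence ecc_3 >= D everywhere, and ecc_3 >= D + 1 off the D - 1 interior
    vertices of P unless T is the path P itself. For T'_{n,2r-1} these bounds
    with D = d = 2r - 1 are not exceeded: three vertices span a subtree with
    the spine v_1, ..., v_{d-1}, in which each leaf adds one edge. *)

Require Import Defs.
From mathcomp Require Import all_boot all_order all_algebra.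
From mathcomp Require Import zify.

Import Order.TTheory GRing.Theory Num.Theory.

(** * Walks, geodesics and the metric of a connected graph *)

Section Distance.
Variable G : sgraph.
Implicit Types (x y z : G) (p : seq G).

Lemma dist_le_size x p : path (@adj G) x p -> dist x (last x p) <= size p.
Proof.
move=> xp; rewrite /dist -minEnat; have [lt_pG|le_Gp] := ltnP (size p) #|G|.
  rewrite -leEnat; apply: (bigmin_inf (Ordinal lt_pG)) => //=.
  by apply/existsP; exists (in_tuple p); rewrite /= xp eqxx.
(* A walk with at least [#|G|] steps is out of range, but the minimum never exceeds its default
   value [#|G|]. *)
by apply: leq_trans le_Gp; rewrite -leEnat; apply: bigmin_le_id.
Qed.

(** Making a walk of minimal length simple cannot shorten it, since [dist_le_size] applies to the
    new walk as well. *)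
Lemma dist_geodesic x y : connect (@adj G) x y ->
  exists p, [/\ path (@adj G) x p, last x p = y, uniq (x :: p)
              & size p = dist x y].
Proof.
case/connectP=> _ /shortenP[p xp Up _] def_y.
(* A simple walk has fewer than [#|G|] steps, so the range of the minimum is nonempty and the
   minimum is attained. *)
have lt_pG: size p < #|G|.
  have := uniq_leq_size Up (fun z _ => mem_enum G z).
  by rewrite -cardE.
pose P (k : 'I_#|G|) :=
  [exists q : k.-tuple G, path (@adj G) x q && (last x q == y)].
have Pp: P (Ordinal lt_pG).
  by apply/existsP; exists (in_tuple p); rewrite /= xp def_y eqxx.
have leG (k : 'I_#|G|): P k -> (nat_of_ord k <= #|G|)%O by rewrite leEnat ltnW.
have [k /existsP[q /andP[xq /eqP qy]] dist_k] := eq_bigmin _ _ _ Pp leG.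
have{dist_k} size_q: size q = dist x y.
  by rewrite size_tuple /dist -minEnat -dist_k.
case: (shortenP xq) qy => q' xq' Uq' sub_q' q'y.
have /eqP eq_q'q: size q' == size q.
  rewrite eqn_leq uniq_leq_size //=; last by case/andP: Uq'.
  by rewrite size_q -q'y dist_le_size.
by exists q'; rewrite eq_q'q.
Qed.

Lemma dist_sym : connected_graph G -> commutative (@dist G).
Proof.
move=> Gconn; suffices le_dist x y: dist y x <= dist x y.
  by move=> x y; apply/eqP; rewrite eqn_leq !le_dist.
have [p [xp <- _ <-]] := dist_geodesic _ _ (Gconn x y).
have: path (@adj G) (last x p) (rev (belast x p)).
  by rewrite rev_path (eq_path (e' := @adj G)) // => u v; apply: adj_sym.
by move/dist_le_size; case: p {xp} => [|a p] //=;
  rewrite rev_cons last_rcons size_rcons size_rev size_belast.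
Qed.

Lemma dist_triangle : connected_graph G ->
  forall x y z, dist x z <= dist x y + dist y z.
Proof.
move=> Gconn x y z.
have [p [xp py _ <-]] := dist_geodesic _ _ (Gconn x y).
have [q [yq <- _ <-]] := dist_geodesic _ _ (Gconn y z).
by rewrite -size_cat -py -last_cat dist_le_size // cat_path xp py.
Qed.

End Distance.

(** * Edges of an acyclic graph as bridges *)

Section Bridges.
Variable G : sgraph.
Implicit Types (x y z : G) (p : seq G) (A : {set G}).

Definition adj_avoiding A : rel G :=
  [rel u v | adj u v && ([set u; v] != A)].

Lemma connect_avoiding_sym A : connect_sym (adj_avoiding A).
Proof.
by apply: sym_connect_sym => u v; rewrite /adj_avoiding /= adj_sym setUC.
Qed.

(** The ends of each edge of the walk lie on the walk, so no such edge contains [z]. *)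
Lemma connect_avoiding A x p z :
  path (@adj G) x p -> z \in A -> z \notin x :: p ->
  connect (adj_avoiding A) x (last x p).
Proof.
move=> xp Az z'p; apply/connectP; exists p => //.
elim: p x xp z'p => //= a p IHp x /andP[xa ap].
rewrite inE negb_or => /andP[zx z'ap]; rewrite IHp // andbT.
rewrite /adj_avoiding /= xa /=.
apply: contraNneq zx => eA; move: Az z'ap; rewrite -eA !inE negb_or.
by case/orP=> // ->.
Qed.

(** A simple detour has at least two steps, and the edge from [y] to [x] closes it to a cycle on
    three or more vertices. *)
Lemma bridge x y : acyclic_graph G -> adj x y ->
  ~~ connect (adj_avoiding [set x; y]) x y.
Proof.
move=> Gacy xy; apply/negP=> /connectP[_ /shortenP[[|a [|b p]] xp Up _] def_y].
- by rewrite def_y /= adj_irr in xy.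
- by move: xp; rewrite def_y /= /adj_avoiding /= eqxx andbF.
apply: (Gacy [:: x, a, b & p]) => //; rewrite /ucycle Up andbT.
rewrite [cycle _ _]rcons_path -def_y adj_sym xy andbT.
by apply: sub_path xp => u v /andP[].
Qed.

Lemma mem_edges x y : ([set x; y] \in edges G) = adj x y.
Proof.
apply/idP/idP=> [|xy]; rewrite inE; last first.
  by apply/existsP; exists x; apply/existsP; exists y; rewrite xy eqxx.
case/existsP=> u /existsP[v /andP[uv /eqP def_xy]].
have := set22 u v; have := set21 u v; rewrite -def_xy.
case/set2P=> u_xy /set2P[v_xy|v_xy]; move: uv; rewrite u_xy v_xy ?adj_irr //.
by rewrite adj_sym.
Qed.

Definition path_edges x p := pairmap (fun u v => [set u; v]) x p.

Lemma path_edgesP x p e : e \in path_edges x p ->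
  exists p1 b p2, p = p1 ++ b :: p2 /\ e = [set last x p1; b].
Proof.
elim: p x => //= a p IHp x; rewrite inE => /predU1P[->|/IHp].
  by exists [::], a, p.
by case=> p1 [b [p2 [-> ->]]]; exists (a :: p1), b, p2.
Qed.

Lemma path_edges_sub x p e u :
  e \in path_edges x p -> u \in e -> u \in x :: p.
Proof.
case/path_edgesP=> p1 [b [p2 [-> ->]]].
rewrite -cat_cons mem_cat => /set2P[]->; first by rewrite mem_last.
by rewrite mem_head orbT.
Qed.

Lemma path_edges_uniq x p : uniq (x :: p) -> uniq (path_edges x p).
Proof.
elim: p x => // a p IHp x /andP[x'ap /IHp Up]; rewrite /= Up andbT.
by apply: contra x'ap => /path_edges_sub-> //; rewrite set21.
Qed.

(** If an edge [a b] of the path were missing from [H], one could go from [a] back to [x], through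
    [H] to the other end, and back along the path to [b], bypassing a bridge. *)
Lemma path_edges_subgraph (H : {set G} * {set {set G}}) x p :
  acyclic_graph G -> connected_subgraph H -> path (@adj G) x p ->
  uniq (x :: p) -> x \in H.1 -> last x p \in H.1 ->
  {subset path_edges x p <= H.2}.
Proof.
move=> Gacy /andP[/andP[sHE _] Hconn] xp Up xH yH.
move=> _ /path_edgesP[p1 [b [p2 [def_p ->]]]].
set a := last x p1.
move: Up; rewrite def_p -cat_cons cat_uniq => /and3P[_ Up12 _].
move: xp yH; rewrite def_p cat_path last_cat /= -/a => /and3P[xp1 ab bp2] yH.
apply: contraT => abH; rewrite -(negbTE (bridge _ _ Gacy ab)).
have ax: connect (adj_avoiding [set a; b]) a x.
  rewrite connect_avoiding_sym; apply: (connect_avoiding _ _ _ b) => //.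
    by rewrite set22.
  by apply: contra Up12 => bp1; apply/hasP; exists b; rewrite ?mem_head.
have yb: connect (adj_avoiding [set a; b]) (last b p2) b.
  rewrite connect_avoiding_sym; apply: (connect_avoiding _ _ _ a) => //.
    by rewrite set21.
  by apply: contra Up12 => ap2; apply/hasP; exists a; rewrite ?mem_last.
apply: connect_trans ax (connect_trans _ yb).
have /forall_inP/(_ _ xH)/forall_inP/(_ _ yH) := Hconn.
apply: connect_sub => u v /= uvH; apply: connect1.
apply/andP; split; last first.
  by apply: contraNneq abH => <-.
by rewrite -mem_edges (subsetP sHE).
Qed.

End Bridges.

(** * Lower and upper bounds for Steiner distances *)

Section Steiner.
Variable G : sgraph.
Implicit Types (x y z v : G) (p : seq G) (S A : {set G}).

Lemma steiner_dist_geP S k : connected_graph G ->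
  (forall H, connected_subgraph H -> S \subset H.1 -> k <= #|H.2|) ->
  k <= @steiner_dist G S.
Proof.
move=> Gconn le_k; rewrite /steiner_dist -minEnat -leEnat.
apply/bigmin_geP; split=> [|H /andP[Hconn sSH]]; last exact: le_k.
(* The default value of the minimum is the size of the whole graph, itself a connected subgraph. *)
apply: (le_k (setT, edges G)); last exact: subsetT.
rewrite /connected_subgraph /is_subgraph subxx /=; apply/andP; split.
  by apply/forall_inP=> A _; apply: subsetT.
apply/forall_inP=> x _; apply/forall_inP=> y _.
by rewrite (eq_connect (e' := @adj G)) // => u v; apply: mem_edges.
Qed.

(** For [v] off the path, the first edge of a walk in [H] from [v] to [x] contains [v], hence is not
    a path edge and adds one to the count. *)
Lemma steiner_dist_ge x p v S :
  connected_graph G -> acyclic_graph G -> path (@adj G) x p -> uniq (x :: p) ->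
  x \in S -> last x p \in S -> v \in S ->
  size p + (v \notin x :: p) <= steiner_dist S.
Proof.
move=> Gconn Gacy xp Up xS yS vS; apply: steiner_dist_geP => // H Hconn sSH.
have sPH: {subset path_edges _ x p <= H.2}.
  by apply: path_edges_subgraph; rewrite ?(subsetP sSH).
have size_P: size (path_edges _ x p) = size p by rewrite size_pairmap.
have Uedges := path_edges_uniq _ _ _ Up.
rewrite -size_P.
have [|v'p] := boolP (v \in x :: p); rewrite ?addn0 ?addn1 /=.
  by move=> _; rewrite cardE uniq_leq_size // => e /sPH; rewrite mem_enum.
have /andP[_ /forall_inP/(_ v)] := Hconn.
move=> /(_ (subsetP sSH v vS))/forall_inP/(_ x (subsetP sSH x xS)).
case/connectP=> [[_ xv|a q /= /andP[vaH _] _]].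
  by rewrite xv /= mem_head in v'p.
pose es := [set v; a] :: path_edges G x p.
have Ues: uniq es.
  rewrite /= Uedges andbT; apply: contra v'p => /path_edges_sub->//.
  exact: set21.
rewrite cardE (uniq_leq_size Ues) // => e.
by rewrite mem_enum inE => /predU1P[->|/sPH].
Qed.

(* An edge at [v] towards its parent is paid for by [v] itself, so a rooted
   subtree on [A] has at most [#|A|.-1] edges. *)
Lemma steiner_dist_rooted (root : G) (par : G -> G) (rank : G -> nat) S A :
  S \subset A -> root \in A ->
  (forall x, x \in A -> x != root ->
     [/\ par x \in A, adj x (par x) & rank (par x) < rank x]) ->
  steiner_dist S <= #|A|.-1.
Proof.
move=> sSA Aroot parP.
pose E := [set [set x; par x] | x in A :\ root].
have leE: #|E| <= #|A|.-1.
  by rewrite (cardsD1 root A) Aroot leq_imset_card.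
apply: leq_trans leE; rewrite /steiner_dist -minEnat -leEnat.
apply: (bigmin_inf (A, E)); rewrite //= sSA andbT.
rewrite /connected_subgraph /is_subgraph /= -andbA; apply/and3P; split.
- apply/subsetP=> _ /imsetP[x /setD1P[x'r Ax] ->].
  by rewrite mem_edges; case: (parP x).
- apply/forall_inP=> _ /imsetP[x /setD1P[x'r Ax] ->].
  by apply/subsetP=> u /set2P[]-> //; case: (parP x).
set e := [rel u v | _].
have e_sym: connect_sym e.
  by apply: sym_connect_sym => u v; rewrite /e /= setUC.
have to_root x: x \in A -> connect e x root.
  elim: {x}_.+1 {-2}x (ltnSn (rank x)) => // k IHk x le_xk Ax.
  have [->//|x'r] := eqVneq x root; have [Apx _ lt_px] := parP x Ax x'r.
  apply: connect_trans (IHk _ (leq_trans lt_px le_xk) Apx).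
  by apply: connect1; apply: imset_f; rewrite !inE x'r.
apply/forall_inP=> x Ax; apply/forall_inP=> y Ay.
by apply: connect_trans (to_root x Ax) _; rewrite e_sym to_root.
Qed.

End Steiner.

(** * Radius, diameter and [ecc3] in a tree *)

Section Trees.
Variable G : sgraph.
Hypotheses (Gconn : connected_graph G) (Gacy : acyclic_graph G).
Implicit Types (x y z v w : G) (p : seq G).

(* The edge entering [c] on [x -- y] would otherwise be bypassed through [z]. *)
Lemma middle_separates x p1 p2 q1 q2 (c := last x p1) :
  path (@adj G) x (p1 ++ p2) -> uniq (x :: p1 ++ p2) ->
  path (@adj G) x q1 -> c \notin x :: q1 ->
  path (@adj G) (last c p2) q2 -> c \notin last c p2 :: q2 ->
  last x q1 != last (last c p2) q2.
Proof.
(* For empty [p1], [c] is [x], which lies on [x :: q1]; otherwise the last edge [a c] of [p1] is the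
   bridge. *)
rewrite {}/c; case/lastP: p1 => [|p1 c] //; rewrite ?mem_head // last_rcons.
rewrite cat_rcons -cat_cons cat_uniq cat_path => /and3P[xp1 ac cp2].
set a := last x p1 in ac; case/and3P=> _ Up12 _ xq1 c'q1 yq2 c'q2.
apply: contraNneq (bridge G a c Gacy ac) => eq_z.
have c_ac : c \in [set a; c] by rewrite set22.
have ax: connect (adj_avoiding G [set a; c]) a x.
  rewrite connect_avoiding_sym; apply: connect_avoiding c_ac _ => //.
  by apply: contra Up12 => cp1; apply/hasP; exists c; rewrite ?mem_head.
have yc: connect (adj_avoiding G [set a; c]) (last c p2) c.
  rewrite connect_avoiding_sym; apply: (connect_avoiding _ _ _ _ a) => //.
    by rewrite set21.
  by apply: contra Up12 => ap2; apply/hasP; exists a; rewrite ?mem_last.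
(* The bypass runs from [a] to [x], along [q1] to the supposed common end, back along [q2], and then
   to [c]. *)
apply: connect_trans ax (connect_trans _ yc).
apply: connect_trans (connect_avoiding _ _ _ _ _ xq1 c_ac c'q1) _.
by rewrite eq_z connect_avoiding_sym; apply: connect_avoiding c_ac _.
Qed.

Lemma dist_through x z q c : path (@adj G) x q -> last x q = z ->
  size q = dist x z -> c \in x :: q -> dist x c + dist c z <= dist x z.
Proof.
move=> xq qz size_q /splitPl def_q; case: def_q xq qz size_q => q1 q2 <-.
rewrite cat_path last_cat size_cat => /andP[xq1 cq2] <- <-.
by rewrite leq_add ?dist_le_size.
Qed.

(** Let [c] be the middle of a longest geodesic. For every [z], the geodesic to [z] from [x] or from
    [y] passes through [c]; having length at most [D], it leaves at most [uphalf D] from [c] to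
    [z]. *)
Lemma radius_le_uphalf_diameter x y :
  (forall u v, dist u v <= dist x y) -> radius G <= uphalf (dist x y).
Proof.
move=> xy_max; have [p [xp py Up size_p]] := dist_geodesic G x y (Gconn x y).
set D := dist x y in xy_max size_p *.
pose p1 := take D./2 p; pose p2 := drop D./2 p; pose c := last x p1.
have size_p1: size p1 = D./2 by rewrite size_takel // size_p; lia.
have size_p2: size p2 = uphalf D by rewrite size_drop size_p; lia.
have def_p: p = p1 ++ p2 by rewrite cat_take_drop.
have yE: last c p2 = y by rewrite -py def_p last_cat.
have:= xp; rewrite def_p cat_path -/c.
case/andP=> /dist_le_size le_xc /dist_le_size.
rewrite yE size_p2 => le_cy; rewrite size_p1 -/c in le_xc.
(* Together with the two upper bounds, this makes the distances from [c] to [x] and [y] exactly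
   [D./2] and [uphalf D]. *)
have:= dist_triangle G Gconn x c y; rewrite -/D => ge_D.
suffices le_c z: dist c z <= uphalf D.
  have ecc_c: ecc c <= uphalf D by apply/bigmax_leqP=> z _; apply: le_c.
  by apply: leq_trans ecc_c; rewrite /radius -minEnat -leEnat; apply: bigmin_le.
have [q1 [xq1 q1z _ size_q1]] := dist_geodesic G x z (Gconn x z).
have [q2 [yq2 q2z _ size_q2]] := dist_geodesic G y z (Gconn y z).
have := xy_max x z; have := xy_max y z.
have [cq1|c'q1] := boolP (c \in x :: q1).
  by have := dist_through _ _ _ _ xq1 q1z size_q1 cq1; lia.
have [cq2|c'q2] := boolP (c \in y :: q2).
  have := dist_through _ _ _ _ yq2 q2z size_q2 cq2.
  by rewrite (dist_sym _ Gconn y c); lia.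
rewrite def_p in xp Up; rewrite -yE in yq2 c'q2 q2z.
have := middle_separates _ _ _ _ _ xp Up xq1 c'q1 yq2 c'q2.
by rewrite q1z q2z eqxx.
Qed.

Lemma ecc3_ge x p v w :
  path (@adj G) x p -> uniq (x :: p) -> x != last x p ->
  w != x -> w != last x p -> v \in w |: [set x; last x p] ->
  size p + (w \notin x :: p) <= ecc3 v.
Proof.
move=> xp Up xy wx wy vS; set S := _ |: _ in vS.
have cardS: #|S| == 3 by rewrite cardsU1 !inE negb_or wx wy cards2 xy.
have: size p + (w \notin x :: p) <= steiner_dist S.
  by apply: steiner_dist_ge; rewrite ?inE ?eqxx ?orbT.
by move/leq_trans; apply; apply: leq_bigmax_cond; rewrite vS cardS.
Qed.

Lemma sum_ecc3_ge x p :
  path (@adj G) x p -> uniq (x :: p) -> 1 < size p ->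
  size p * #|G| + (if (size p).+1 < #|G| then #|G| - (size p).-1 else 0)
    <= \sum_(v : G) ecc3 v.
Proof.
(* From here on [p] lists only the interior vertices of the path. *)
case/lastP: p => // p y; rewrite size_rcons => xp Up p_gt0.
have yE: last x (rcons p y) = y by rewrite last_rcons.
have /and3P[x'py y'p Up']: [&& x \notin rcons p y, y \notin p & uniq p].
  by rewrite -rcons_uniq.
have [x'y x'p]: x != y /\ x \notin p.
  by move: x'py; rewrite mem_rcons inE negb_or => /andP[].
set lt_n := _ < #|G|.
(* The companion [w] of the two ends is taken off the path if possible, otherwise in its nonempty
   interior. *)
have [w [wx wy w'p]]: exists w, [/\ w != x, w != y
    & lt_n <= (w \notin x :: rcons p y)].
  have [lt_pn|le_np] := boolP lt_n.
    have [w w'p|] := pickP [predC x :: rcons p y].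
      exists w; rewrite -[_ \notin _]/([predC x :: rcons p y] w) w'p.
      split=> //.
        by apply: contraTneq w'p => ->; rewrite /= mem_head.
      by apply: contraTneq w'p => ->; rewrite /= inE mem_rcons mem_head orbT.
    move=> all_p; move: lt_pn; rewrite /lt_n ltnNge -(size_rcons p y).
    rewrite -[(size _).+1]/(size (x :: _)) cardE.
    rewrite uniq_leq_size ?enum_uniq // => v _.
    by have /negbFE := all_p v.
  case: p p_gt0 {xp Up x'py Up' le_np lt_n yE} y'p x'p => // w p _.
  rewrite !inE !negb_or => /andP[yw _] /andP[xw _].
  by exists w; rewrite eq_sym xw eq_sym yw.
(* An end of the path is completed by [w]; any other [v] is itself the third vertex. *)
have ecc3_v v: (size p).+1 + ((v \notin p) && lt_n) <= ecc3 v.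
  have := ecc3_ge x (rcons p y) v; rewrite yE size_rcons => ecc3_v.
  have [v_xy|] := boolP (v \in [set x; y]).
    have:= ecc3_v w xp Up x'y wx wy; rewrite inE v_xy orbT => /(_ isT).
    apply: leq_trans; rewrite leq_add2l; apply: leq_trans w'p.
    by case: (v \notin p).
  rewrite !inE negb_or => /andP[vx vy].
  have:= ecc3_v v xp Up x'y vx vy; rewrite setU11 => /(_ isT); apply: leq_trans.
  rewrite leq_add2l inE mem_rcons inE !negb_or vx vy /=.
  by case: (v \notin p); rewrite //= leq_b1.
apply: (@leq_trans (\sum_(v : G) ((size p).+1 + ((v \notin p) && lt_n))));
  last by apply: leq_sum => v _; apply: ecc3_v.
rewrite big_split sum_nat_const mulnC leq_add2l.
case: lt_n {w'p ecc3_v} => //=.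
under eq_bigr do rewrite andbT.
rewrite leq_subLR -(cardC (mem p)) leq_add ?card_size //.
by rewrite -sum1_card big_mkcond.
Qed.

End Trees.

(** * Upper bound for a path with pendent vertices *)

Section PathWithPendantsUpper.
Variables (d : nat) (p : nat -> nat).
Hypothesis d_gt1 : 1 < d.
Let G := path_with_pendants d p.

(** The ends [v_0] and [v_d] are left out, so that every vertex off the spine is a leaf attached to
    it. *)
Definition spine : {set G} :=
  [set x : G | if x is inl i then 0 < i < d else false].

Lemma card_spine : #|spine| = d.-1.
Proof.
pose f (i : 'I_d.-1) : G := inl (inord i.+1).
have fE (i : 'I_d.-1) : (inord i.+1 : 'I_d.+1) = i.+1 :> nat.
  by rewrite inordK //; have := ltn_ord i; lia.
have f_inj : injective f.
  move=> i j eq_f; have eq_ij: inord i.+1 = inord j.+1 :> 'I_d.+1 by case: eq_f.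
  by apply/val_inj/succn_inj; have := congr1 val eq_ij; rewrite /= !fE.
rewrite -[RHS]card_ord -(card_imset _ f_inj); apply: eq_card => x.
rewrite inE; apply/idP/imsetP => [|[i _ ->]]; last first.
  by rewrite /f /= fE; have := ltn_ord i; lia.
case: x => // i i_d; have lt_i: i.-1 < d.-1 by lia.
exists (Ordinal lt_i) => //; congr inl; apply: val_inj => /=.
by rewrite inordK; lia.
Qed.

(** The spine and the leaves in [S] form a subtree rooted at [v_1], with one edge fewer than
    vertices. *)
Lemma steiner_dist_spine (S : {set G}) :
  steiner_dist S <= (d.-1 + #|S :\: spine|).-1.
Proof.
pose root : G := inl (inord 1).
pose par (x : G) : G := match x with
  | inl i => inl (inord (if i == 0 :> nat then 1 else i.-1))
  | inr u => inl (inord (tag u).+1)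
  end.
(* Path indices decrease towards [v_1], except at [v_0], whose rank is raised above the spine like
   that of a pendent vertex. *)
pose rank (x : G) := match x with
  | inl i => if i == 0 :> nat then d.+1 else i : nat
  | inr _ => d.+1
  end.
have one_d: 1 < d.+1 by lia.
rewrite -card_spine -cardsUI.
have -> : spine :&: (S :\: spine) = set0.
  by apply/setP=> x; rewrite in_setI in_setD in_set0; case: (x \in spine).
rewrite cards0 addn0.
apply: (steiner_dist_rooted _ root par rank).
- by apply/subsetP=> x Sx; rewrite in_setU in_setD Sx andbT orbN.
- by rewrite in_setU [root \in spine]inE /= inordK // d_gt1.
move=> x _ x'r.
suffices [spx xpx ltpx]:
    [/\ par x \in spine, adj x (par x) & rank (par x) < rank x].
  by rewrite in_setU spx.
case: x x'r => [i|u] x'r; rewrite inE /=.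
  have := ltn_ord i; have [i0|i_neq0] := eqVneq (i : nat) 0 => lt_i.
    by rewrite inordK //= i0; split=> //; lia.
  have i_neq1: i != 1 :> nat.
    apply: contraNneq x'r => i1; apply/eqP; congr inl; apply: val_inj.
    by rewrite /= inordK.
  rewrite inordK; last lia; have -> : (i.-1 == 0) = false by lia.
  by split; lia.
case: u {x'r} => j k /=; have lt_j := ltn_ord j.
by rewrite inordK; last lia; split=> /=; lia.
Qed.

Lemma sum_ecc3_path_with_pendants_le :
  \sum_(v : G) ecc3 v <=
    d * #|G| + (if d.+1 < #|G| then #|G| - d.-1 else 0).
Proof.
have leaves: #|~: spine| = #|G| - d.-1 by rewrite cardsCs setCK card_spine.
have ecc3_v (v : G) : ecc3 v <= d + ((v \notin spine) && (d.+1 < #|G|)).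
  apply/bigmax_leqP=> S /andP[vS /eqP cardS].
  apply: leq_trans (steiner_dist_spine S) _.
  have le_leaves: #|S :\: spine| <= #|G| - d.-1.
    by rewrite -leaves subset_leq_card // setDE subsetIr.
  have le3: #|S :\: spine| <= 3 by rewrite -cardS subset_leq_card // subsetDl.
  (* A triple through a spine vertex has at most two leaves, giving [d] edges. Three leaves give
     [d + 1], and exist only if [#|G| - d.-1] is at least 3. *)
  have [v_spine|_] := boolP (v \in spine); last first.
    move: #|S :\: spine| #|G| le3 le_leaves => l N; case: ltnP => /=; lia.
  have: #|S :\: spine| < 3.
    rewrite -cardS proper_card // properE subsetDl; apply/subsetPn.
    by exists v; rewrite // in_setD v_spine.
  by rewrite addn0; move: #|_ :\: _| => l; lia.
apply: (@leq_trans (\sum_(v : G) (d + ((v \notin spine) && (d.+1 < #|G|)))));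
  first by apply: leq_sum => v _; apply: ecc3_v.
rewrite big_split sum_nat_const mulnC leq_add2l.
case: ifP => _; last by rewrite big1 // => v _; rewrite andbF.
under eq_bigr do rewrite andbT -in_setC.
by rewrite -leaves -sum1_card [leqRHS]big_mkcond.
Qed.

Lemma card_path_with_pendants : #|G| = d.+1 + \sum_(1 <= i < d) p i.
Proof.
rewrite card_sum card_ord card_tagged sumnE big_map big_enum /=.
congr (_ + _); rewrite -[in RHS](ltn_predK d_gt1) big_add1 /= big_mkord.
by apply: eq_bigr => i _; rewrite card_ord.
Qed.

End PathWithPendantsUpper.

(** * The extremal tree and the comparison of the two sums *)

Lemma card_Tprime n r : 1 < r -> 2 * r <= n -> #|Tprime n (2 * r - 1)| = n.
Proof.
move=> r_gt1 le_rn; rewrite card_path_with_pendants; last by lia.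
have -> : \sum_(1 <= i < 2 * r - 1) Tprime_pendants n (2 * r - 1) i = n - 2 * r.
  (* For [d = 2 * r - 1] the pendent vertices sit at the indices [r.-1] and [r] only, and the two
     halves add up to [n - 2 * r]. *)
  rewrite (@big_cat_nat _ _ _ r.-1) /=; [|lia..].
  rewrite [X in X + _]big_nat_cond big1 ?add0n; last first.
    by move=> i; rewrite /Tprime_pendants => *; do 2?case: eqP; lia.
  rewrite big_ltn; last lia; rewrite big_ltn; last lia.
  rewrite big_nat_cond big1 ?addn0; last first.
    by move=> i; rewrite /Tprime_pendants => *; do 2?case: eqP; lia.
  by rewrite /Tprime_pendants; do 3?case: eqP; lia.
by lia.
Qed.

Theorem corollary5p8 (T : sgraph) (n r : nat)
  (treeT : is_tree T) (orderT : #|T| = n) (radT : radius T = r)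
  (r_gt1 : 1 < r) :
  (aecc3 (Tprime n (2 * r - 1)) <= aecc3 T)%R.
Proof.
case: treeT => /card_gt0P[x0 _] Tconn Tacy.
have [[x y] _ xy_max] :=
  @arg_maxnP _ (x0, x0) xpredT (fun u : T * T => dist u.1 u.2) isT.
have{}xy_max u v : dist u v <= dist x y := xy_max (u, v) isT.
have := radius_le_uphalf_diameter T Tconn Tacy x y xy_max.
rewrite radT => le_rD.
have [p [xp _ Up size_p]] := dist_geodesic T x y (Tconn x y).
have le_pn: size p < n.
  by rewrite -orderT cardE (uniq_leq_size Up) // => z _; rewrite mem_enum.
set d := 2 * r - 1; have le_dp: d <= size p by rewrite size_p /d; lia.
have card_T': #|Tprime n d| = n by apply: card_Tprime => //; lia.
have sumT' : \sum_(v : Tprime n d) ecc3 v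
    <= d * n + (if d.+1 < n then n - d.-1 else 0).
  rewrite -[n in d * n]card_T' -[n in _ < n]card_T' -[n in n - _]card_T'.
  by apply: sum_ecc3_path_with_pendants_le; lia.
have sumT : size p * n + (if (size p).+1 < n then n - (size p).-1 else 0)
    <= \sum_(v : T) ecc3 v.
  by rewrite -orderT; apply: sum_ecc3_ge => //; lia.
rewrite /aecc3 card_T' orderT ler_pM2r; last first.
  by rewrite invr_gt0 ltr0n; lia.
rewrite ler_nat (leq_trans sumT') // (leq_trans _ sumT) //.
(* Both bounds are one expression, at [d] and at the diameter. If these differ, the larger main term
   gains at least [n], which covers the extra [n - d.-1]. *)
have [->//|p'd] := eqVneq d (size p).
have: d.+1 * n <= size p * n by rewrite leq_mul2r; lia.
by rewrite mulSn; case: ifP; lia.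
Qed.
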